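(* $\mathrm{SC}_d$-directed tree-width is not closed under taking butterfly minors: there exist finite simple digraphs $D$ and $D'$ such that $D'$ is a butterfly minor of $D$ and $\mathrm{SC}_d(D') > \mathrm{SC}_d(D)$.
   Context: All digraphs are finite and simple. An edge $(u,v)$ is butterfly contractible if it is the only edge with tail $u$ or the only edge with head $v$; a butterfly minor of $D$ is a digraph obtained from a subgraph of $D$ by contracting butterfly contractible edges. An abstract digraph decomposition of $D$ is a triple $(T,\beta,\gamma)$ with $T$ a rooted directed tree (edges directed away from the root), $\beta:V(T)\to 2^{V(D)}$, $\gamma:E(T)\to 2^{V(D)}$, $\bigcup_t\beta(t)=V(D)$. Let $\Gamma(t)=\beta(t)\cup\bigcup_{e\text{ incident with }t}\gamma(e)$, $T_t$ the subtree of nodes reachable from $t$, $\beta(T_t)=\bigcup_{t'\in V(T_t)}\beta(t')$; width $=\max_t|\Gamma(t)|-1$. An $\mathrm{SC}_d$-directed tree decomposition is an abstract digraph decomposition such that (1) $\{\beta(t)\}$ is a partition of $V(D)$ into nonempty sets; (2) for every $e=(s,t)\in E(T)$, $\beta(T_t)$ is the vertex set of a strong component of $D-\gamma(e)$; (3) for every $t\in V(T)$ with children $t_1,\dots,t_l$, $\left(\bigcup_{i=1}^l\beta(T_{t_i})\right)\cap\bigcup_{e\text{ incident with }t}\gamma(e)=\emptyset$. $\mathrm{SC}_d(D)$ is the minimum width of such a decomposition. *)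

(* Defs.v *)
From HB Require Import structures.
From mathcomp Require Import all_boot.

Set Implicit Arguments.
Unset Strict Implicit.
Unset Printing Implicit Defensive.

(* [edge u v] is the edge with tail u and head v. As usual for digraphs,
   "simple" forbids loops and parallel edges but not pairs of antiparallel
   edges. *)
Record digraph := Digraph {
  vertex :> finType;
  edge : rel vertex;
  edge_irr : irreflexive edge
}.
Arguments edge {d}.

(* Subgraphs and contractions are taken up to isomorphism. *)
Definition subdigraph (H D : digraph) : Prop :=
  exists f : H -> D,
    injective f /\ forall x y, edge x y -> edge (f x) (f y).

Definition butterfly_contractible (D : digraph) (u v : D) : Prop :=
  edge u v /\
  ((forall w, edge u w -> w = v) \/ (forall w, edge w v -> w = u)).

(* f is the quotient map identifying u with v; the loops and parallel edges
   that arise are discarded, as digraphs are simple. *)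
Definition contraction_of (D : digraph) (u v : D) (D' : digraph) : Prop :=
  exists f : D -> D',
    [/\ forall a, exists x, f x = a,
        forall x y, f x = f y <->
          [\/ x = y, x = u /\ y = v | x = v /\ y = u]
      & forall a b, edge a b <->
          a <> b /\ exists x y, [/\ f x = a, f y = b & edge x y]].

Inductive butterfly_contracts (D : digraph) : digraph -> Prop :=
| Butterfly_refl : butterfly_contracts D D
| Butterfly_step (G G' : digraph) (u v : G) :
    butterfly_contracts D G -> butterfly_contractible u v ->
    contraction_of u v G' -> butterfly_contracts D G'.

Definition butterfly_minor (D' D : digraph) : Prop :=
  exists H : digraph, subdigraph H D /\ butterfly_contracts H D'.

Definition rooted_directed_tree (T : finType) (arc : rel T) (r : T) : Prop :=
  [/\ forall s, ~~ arc s r,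
      forall t, t != r -> exists! s, arc s t
    & forall t, connect arc r t].

(* Only the values [guard s t] with [tarc s t] are meaningful; every use of
   [guard] below is restricted to such pairs. *)
Record abstract_decomposition (D : digraph) := AbstractDecomposition {
  node : finType;
  tarc : rel node;
  root : node;
  bag : node -> {set D};
  guard : node -> node -> {set D};
  tarc_tree : rooted_directed_tree tarc root;
  bag_cover : \bigcup_t bag t = [set: D]
}.

Section Decomposition.
Variables (D : digraph) (X : abstract_decomposition D).
Implicit Types t : node X.

Definition incident_guards t : {set D} :=
  (\bigcup_(s | tarc s t) guard s t) :|: (\bigcup_(s | tarc t s) guard t s).

Definition Gamma t : {set D} := bag t :|: incident_guards t.

Definition bag_below t : {set D} := \bigcup_(s | connect (@tarc D X) t s) bag s.

Definition width : nat := (\max_t #|Gamma t|).-1.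

End Decomposition.

(* The edge relation of D - S, on the vertices of D. *)
Definition del_edge (D : digraph) (S : {set D}) : rel D :=
  [rel u v | [&& u \notin S, v \notin S & edge u v]].

Definition strong_component (D : digraph) (S C : {set D}) : Prop :=
  C \in equivalence_partition
          [rel u v | connect (del_edge S) u v && connect (del_edge S) v u]
          (~: S).

Definition SCd_decomposition (D : digraph) (X : abstract_decomposition D)
    : Prop :=
  [/\ injective (@bag D X) /\ partition [set bag t | t : node X] [set: D],
      forall s t : node X, tarc s t -> strong_component (guard s t) (bag_below t)
    & forall t : node X,
        (\bigcup_(s | tarc t s) bag_below s) :&: incident_guards t = set0].

(* k is the minimum width: SC_d(D) = k. *)
Definition SCd_tree_width (D : digraph) (k : nat) : Prop :=
  (exists X : abstract_decomposition D, SCd_decomposition X /\ width X = k) /\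
  (forall X : abstract_decomposition D, SCd_decomposition X -> k <= width X).

(* Main.v *)
(* A triangle K is joined to two gadgets: digon i receives edges from K minus
   one vertex and leads to an exit x_i, which sends edges to all of K. With the
   edges from x_i back to digon i the width is 2: from the root bag K, the
   strong component x_i + digon i is guarded by two vertices of K, and taking
   x_i as the next bag makes it a single-vertex guard for digon i. Without
   these edges (a subgraph, hence a butterfly minor) x_i is no longer in the
   strong component of digon i; bags being nonempty, the two guards in K cannot
   be traded for x_i within 3 vertices, and some digon with its two guards
   forces a fourth vertex. *)
Require Import Defs.
From mathcomp Require Import all_boot.
From Stdlib Require Import Classical.

Set Implicit Arguments.
Unset Strict Implicit.
Unset Printing Implicit Defensive.

(** * Strong components after deleting a vertex set *)

Lemma connect_del_edge (D : digraph) (S : {set D}) u v :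
  u \notin S -> v \notin S -> edge u v -> connect (del_edge S) u v.
Proof. by move=> uS vS uv; apply/connect1/and3P. Qed.

Section StrongComponents.
Variables (D : digraph) (S C : {set D}).
Hypothesis scC : strong_component S C.

Lemma strong_component_notin u : u \in C -> u \notin S.
Proof. by case/imsetP: scC => x _ ->; rewrite !inE => /andP[]. Qed.

Lemma strong_component_connect u v :
  u \in C -> v \in C -> connect (del_edge S) u v.
Proof.
case/imsetP: scC => x _ ->; rewrite !inE.
move=> /andP[_ /andP[_ ux]] /andP[_ /andP[xv _]].
exact: connect_trans ux xv.
Qed.

Lemma strong_component_closed u v :
  u \in C -> v \notin S -> connect (del_edge S) u v ->
  connect (del_edge S) v u -> v \in C.
Proof.
case/imsetP: scC => x _ ->; rewrite !inE.
move=> /andP[_ /andP[xu ux]] -> uv vu /=.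
by rewrite (connect_trans xu uv) (connect_trans vu ux).
Qed.

(** Walk back from [v] along a path of D - S from [u] to [v]: every vertex on it reaches [v], hence
    [u], so the path stays in [C] and the closure of [A] under predecessors applies at each edge. *)
Lemma strong_component_sub (A : {set D}) v :
  (forall x y, x \in C -> edge x y -> y \in A -> x \in A) ->
  v \in C -> v \in A -> C \subset A.
Proof.
move=> closA vC vA; apply/subsetP => u uC.
case/connectP: (strong_component_connect uC vC) => p.
elim: p u uC => [|z p IHp] u uC /=; first by move=> _ <-.
move=> /andP[uz zp] vE.
have /and3P[_ zS euz] := uz.
have zv : connect (del_edge S) z v by apply/connectP; exists p.
have zC : z \in C.
  apply: (strong_component_closed uC zS (connect1 uz)).
  exact: connect_trans zv (strong_component_connect vC uC).
exact: (closA u z) (IHp z zC zp vE).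
Qed.

End StrongComponents.

(** Adjacency in both directions makes [C] strongly connected. If no edge of D - S enters [C], or
    none leaves it, no closed walk through [u] gets outside, so [C] is maximal. *)
Lemma strong_componentI (D : digraph) (S C : {set D}) u :
  u \in C -> {in C, forall v, v \notin S} ->
  {in C &, forall v w, v != w -> edge v w} ->
  (forall v w, v \notin S -> w \notin S -> edge v w -> w \in C -> v \in C) \/
  (forall v w, v \notin S -> w \notin S -> edge v w -> v \in C -> w \in C) ->
  strong_component S C.
Proof.
move=> uC CS adjC closC; apply/imsetP; exists u; first by rewrite inE CS.
have CC v w : v \in C -> w \in C -> connect (del_edge S) v w.
  move=> vC wC; have [->|vw] := eqVneq v w; first exact: connect0.
  by apply: connect_del_edge; [exact: CS | exact: CS | exact: adjC].
apply/setP=> v; rewrite !inE; apply/idP/and3P => [vC|[_ uv vu]].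
  by split; [exact: CS | exact: CC..].
case: closC => clos.
- case/connectP: vu => p; elim: p v {uv} => [|z p IHp] v /=.
    by move=> _ <-.
  by move=> /andP[/and3P[vS zS vz] zp] /(IHp _ zp); apply: clos.
- case/connectP: uv => p; elim: p u uC {vu} => [|z p IHp] x xC /=.
    by move=> _ ->.
  by move=> /andP[/and3P[xS zS xz] zp] /(IHp _ _ zp); apply; apply: clos xC.
Qed.

(** * Rooted directed trees *)

Section Trees.
Variables (T : finType) (arc : rel T) (r : T).
Hypothesis tree : rooted_directed_tree arc r.

Lemma tree_parent_inj s s' t : arc s t -> arc s' t -> s = s'.
Proof.
case: tree => noin uniq _ st s't.
have /uniq[z [_ zP]] : t != r.
  by apply: contraL st => /eqP ->; apply: noin.
by rewrite -(zP _ st) -(zP _ s't).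
Qed.

Lemma connect_last_arc y z : connect arc y z -> y = z \/
  exists2 w, connect arc y w & arc w z.
Proof.
case/connectP => p; elim/last_ind: p z => [|p w _] z /=; first by left.
rewrite rcons_path last_rcons => /andP[yp wz] ->; right.
by exists (last y p) => //; apply/connectP; exists p.
Qed.

(** Induction on the path from the root to [s]. Since parents are unique, a cycle through [s] also
    passes through the parent of [s], and so on up to the root, which no arc enters. *)
Lemma tree_acyclic s t : arc s t -> ~~ connect arc t s.
Proof.
case: (tree) => noin _ /(_ s)/connectP[p].
elim/last_ind: p s t => [|p z IHp] s t /=.
  move=> _ -> st; apply/negP => /connect_last_arc[ts|[w _]].
    by move: st; rewrite ts (negPf (noin _)).
  by rewrite (negPf (noin _)).
rewrite rcons_path last_rcons => /andP[rp pz] -> {s} zt.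
have {}IHp := IHp _ _ rp erefl pz.
apply/negP => /connect_last_arc[tz|[w tw wz]].
  by rewrite tz in zt; rewrite (tree_parent_inj pz zt) connect0 in IHp.
move/negP: IHp; apply; rewrite (tree_parent_inj pz wz).
exact: connect_trans (connect1 zt) tw.
Qed.

End Trees.

(** * General properties of the decompositions *)

Section Decompositions.
Variables (D : digraph) (X : abstract_decomposition D).
Hypothesis scdX : SCd_decomposition X.
Implicit Types t s : node X.

(** At most one arc enters [t], so this union is its guard, and it is empty at the root; this lets
    the root be treated like the other nodes. *)
Definition in_guard t : {set D} := \bigcup_(s | tarc s t) guard s t.

Lemma in_guard_sub t : in_guard t \subset Gamma t.
Proof. by apply/subsetP => v vt; rewrite !inE vt orbT. Qed.

Lemma in_guardE s t : tarc s t -> in_guard t = guard s t.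
Proof.
move=> st; apply/setP => v; apply/bigcupP/idP => [[s' s't]|vt]; last by exists s.
by rewrite (tree_parent_inj (tarc_tree X) s't st).
Qed.

Lemma in_guard_root : in_guard (Defs.root X) = set0.
Proof.
by apply: big1 => s; case: (tarc_tree X) => noin _ _; rewrite (negPf (noin s)).
Qed.

Lemma bag_below_root : bag_below (Defs.root X) = [set: D].
Proof.
rewrite -(bag_cover X); apply: eq_bigl => s.
by case: (tarc_tree X) => _ _ ->.
Qed.

Lemma bag_neq0 t : bag t != set0.
Proof.
case: scdX => [[_ /and3P[_ _ n0]] _ _].
by apply: contra n0 => /eqP <-; apply: imset_f.
Qed.

Lemma bag_sub_below t : bag t \subset bag_below t.
Proof. exact: (bigcup_sup t). Qed.

Lemma bag_disjoint s t v : v \in bag s -> v \in bag t -> s = t.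
Proof.
case: scdX => [[inj /and3P[_ /trivIsetP tI _]] _ _] vs vt.
apply/inj/eqP; apply/negP => /negP neq.
have dis := tI _ _ (imset_f _ isT) (imset_f _ isT) neq.
by rewrite (disjointFr dis vs) in vt.
Qed.

Lemma below_or_root t :
  strong_component (in_guard t) (bag_below t) \/ t = Defs.root X.
Proof.
have [->|tr] := eqVneq t (Defs.root X); [by right | left].
case: (tarc_tree X) => _ /(_ _ tr)[s [st _]] _.
by rewrite (in_guardE st); case: scdX => _ + _; apply.
Qed.

Lemma bag_below_notin t v : v \in bag_below t -> v \notin in_guard t.
Proof.
case: (below_or_root t) => [sc|->]; first exact: strong_component_notin.
by rewrite in_guard_root inE.
Qed.

Lemma bag_below_closed t u v :
  u \in bag_below t -> v \notin in_guard t ->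
  connect (del_edge (in_guard t)) u v ->
  connect (del_edge (in_guard t)) v u -> v \in bag_below t.
Proof.
case: (below_or_root t) => [sc|->]; first exact: strong_component_closed.
by rewrite bag_below_root inE.
Qed.

(** The bag of [t] is nonempty and avoids the guard, so it adds at least one vertex to [Gamma t]. *)
Lemma card_in_guard t : #|in_guard t| < #|Gamma t|.
Proof.
apply: proper_card; rewrite properE in_guard_sub /=.
have /set0Pn[v vt] := bag_neq0 t.
apply/subsetPn; exists v; first by rewrite !inE vt.
by apply/bag_below_notin/(subsetP (bag_sub_below t)).
Qed.

(** Disjointness of bags and acyclicity exclude the bag of [s]; condition (3) excludes the guards at
    [s]. *)
Lemma below_child s t v : tarc s t -> v \in bag_below t -> v \notin Gamma s.
Proof.
move=> st vt; rewrite inE negb_or; apply/andP; split.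
  apply/negP => vs; case/bigcupP: vt => z tz vz.
  move: (tree_acyclic (tarc_tree X) st).
  by rewrite -(bag_disjoint vz vs) tz.
case: scdX => _ _ /(_ s) s0; apply/negP => vI.
suff: v \in (set0 : {set D}) by rewrite inE.
by rewrite -s0 inE vI andbT; apply/bigcupP; exists t.
Qed.

Lemma child_sub s t : tarc s t -> bag_below t \subset bag_below s.
Proof.
move=> st; apply/bigcupsP => z tz.
exact/bigcup_sup/(connect_trans (connect1 st)).
Qed.

Lemma child_card s t : tarc s t -> #|bag_below t| < #|bag_below s|.
Proof.
move=> st; apply: proper_card; rewrite properE child_sub //=.
have /set0Pn[v vs] := bag_neq0 s.
apply/subsetPn; exists v; first exact: (subsetP (bag_sub_below s)).
by apply: contraL vs => /(below_child st); rewrite !inE negb_or => /andP[].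
Qed.

Lemma ex_child t v : v \in bag_below t -> v \notin Gamma t ->
  exists2 s, tarc t s & v \in bag_below s.
Proof.
case/bigcupP => z /connectP[[|s p] /=]; first by move=> _ -> vt; rewrite !inE vt.
move=> /andP[ts sp] zE vz _; exists s => //.
by apply/bigcupP; exists z => //; apply/connectP; exists p.
Qed.

Lemma child_guard_sub s t : tarc s t -> in_guard t \subset Gamma s.
Proof.
move=> st; rewrite (in_guardE st); apply/subsetP => v vt; rewrite !inE.
by apply/orP; right; apply/orP; right; apply/bigcupP; exists t.
Qed.

Lemma child_strong_component s t : tarc s t ->
  strong_component (in_guard t) (bag_below t).
Proof. by move=> st; rewrite (in_guardE st); case: scdX => _ + _; apply. Qed.

Lemma below_adjacent t u v : u \in bag_below t -> edge u v -> edge v u ->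
  v \notin in_guard t -> v \in bag_below t.
Proof.
move=> ut uv vu vG; have uG := bag_below_notin ut.
by apply: (bag_below_closed ut vG); apply: connect_del_edge.
Qed.

(** A directed triangle that avoids the guard lies in one strong component. *)
Lemma below_triangle t u v w : u \in bag_below t ->
  edge u v -> edge v w -> edge w u ->
  v \notin in_guard t -> w \notin in_guard t ->
  v \in bag_below t /\ w \in bag_below t.
Proof.
move=> ut uv vw wu vG wG; have uG := bag_below_notin ut.
have uv' := connect_del_edge uG vG uv; have vw' := connect_del_edge vG wG vw.
have wu' := connect_del_edge wG uG wu.
by split; apply: (bag_below_closed ut) => //;
  [exact: connect_trans vw' wu' | exact: connect_trans uv' vw'].
Qed.

(* Such a node is found by descending towards the part of the clique that is
   not yet in [Gamma t]: it always lies in a single strong component. *)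
Lemma clique_in_Gamma (Q : {set D}) :
  {in Q &, forall u v, u != v -> edge u v} -> Q != set0 ->
  exists2 t : node X, Q \subset Gamma t & exists2 v, v \in Q & v \in bag_below t.
Proof.
move=> adjQ /set0Pn[v0 v0Q].
have: v0 \in bag_below (Defs.root X) by rewrite bag_below_root.
have [n] := ubnP #|bag_below (Defs.root X)|.
elim: n (Defs.root X) v0 v0Q => // n IHn t v vQ le_n vt.
have [sub|/subsetPn[w wQ wG]] := boolP (Q \subset Gamma t).
  by exists t => //; exists v.
have wt : w \in bag_below t.
  have [<-//|vw] := eqVneq v w.
  apply: (below_adjacent vt); rewrite ?adjQ // 1?eq_sym //.
  by apply: contra wG; apply: (subsetP (in_guard_sub t)).
have [s ts ws] := ex_child wt wG.
by apply: (IHn s w) => //; apply: leq_trans (child_card ts) _.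
Qed.

End Decompositions.

(** * Width bounds and existence of the minimum width *)

Lemma leq_width (D : digraph) (X : abstract_decomposition D) k :
  width X <= k <-> forall t : node X, #|Gamma t| <= k.+1.
Proof.
(* Truncation is harmless: [n - 1 <= k] is equivalent to [n <= k.+1] even for [n = 0]. *)
rewrite /width -subn1 leq_subLR add1n; split => [le t|le].
  exact: leq_trans (leq_bigmax t) le.
by apply/bigmax_leqP.
Qed.

Section TrivialDecomposition.
Variables (D : digraph) (v0 : D).

Lemma unit_tree : rooted_directed_tree (fun _ _ : unit => false) tt.
Proof. by split=> // -[]. Qed.

Lemma unit_bag_cover : \bigcup_(t : unit) [set: D] = [set: D].
Proof. by apply/setP => v; rewrite inE; apply/bigcupP; exists tt. Qed.

Lemma trivial_SCd_decomposition :
  SCd_decomposition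
    (AbstractDecomposition (fun _ _ => set0) unit_tree unit_bag_cover).
Proof.
split=> //=.
- split; first by move=> [] [].
  apply/and3P; split.
  + rewrite /cover; apply/eqP/setP => v; rewrite inE; apply/bigcupP.
    by exists [set: D]; rewrite ?inE //; apply/imsetP; exists tt.
  + by apply/trivIsetP => _ _ /imsetP[x _ ->] /imsetP[y _ ->]; rewrite eqxx.
  + by apply/imsetP => -[x _ /setP/(_ v0)]; rewrite !inE.
- by move=> t; rewrite big_pred0 // set0I.
Qed.

(** The one-node decomposition provides some width, with [v0] making its bag nonempty. Descent to
    the least width uses excluded middle on whether a smaller one is attained. *)
Lemma SCd_tree_width_exists : exists k, SCd_tree_width D k.
Proof.
pose P k := exists X : abstract_decomposition D, SCd_decomposition X /\ width X = k.
suff [k [Pk kmin]] : exists k, P k /\ forall m, P m -> k <= m.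
  by exists k; split=> // X scdX; apply: kmin; exists X.
have [n Pn] : exists n, P n.
  by eexists; eexists; split; first exact: trivial_SCd_decomposition.
elim/ltn_ind: n Pn => n IHn Pn.
have [[m [ltmn Pm]]|nP] := classic (exists m, m < n /\ P m); first exact: IHn Pm.
exists n; split=> // m Pm; rewrite leqNgt; apply/negP => ltmn.
by apply: nP; exists m.
Qed.

End TrivialDecomposition.

(** * The two gadget digraphs *)

(* [inl p] are the vertices of a triangle, and each [i : bool] has a gadget
   with vertices [inr (i, Some j)] (a digon) and [inr (i, None)] (its exit).
   Triangle vertex [Some i] has no edge to digon [i]. The flag [back] adds the
   edges from the exits to the digons. *)
Definition gadget_vertex : finType := (option bool + bool * option bool)%type.

Definition gadget_edge (back : bool) : rel gadget_vertex := fun u v =>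
  match u, v with
  | inl p, inl q => p != q
  | inl p, inr (i, Some _) => p != Some i
  | inl _, inr (_, None) => false
  | inr (i, Some j), inr (i', k) => (i == i') && (k != Some j)
  | inr (_, k), inl _ => k == None
  | inr (i, None), inr (i', k) => [&& back, i == i' & k != None]
  end.

Lemma gadget_edge_irr back : irreflexive (gadget_edge back).
Proof. by move=> [p|[i [j|]]] /=; rewrite ?eqxx ?andbF. Qed.

Definition gadget_digraph back := Digraph (gadget_edge_irr back).

Definition triangle : {set gadget_vertex} := [set inl p | p : option bool].
Definition digon (i : bool) : {set gadget_vertex} := [set inr (i, Some j) | j : bool].

Lemma mem_triangle v : (v \in triangle) = (if v is inl _ then true else false).
Proof. by case: v => p; apply/imsetP; [exists p | case]. Qed.

Lemma mem_digon i v :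
  (v \in digon i) = (if v is inr (i', Some _) then i' == i else false).
Proof.
apply/imsetP; case: v => [p|[i' [j|]]]; try by case.
by case: eqP => [->|ne]; [exists j | case=> j' _ [/ne]].
Qed.

Lemma card_triangle : #|triangle| = 3.
Proof. by rewrite card_imset ?card_option ?card_bool // => p q []. Qed.

Lemma subgadget : subdigraph (gadget_digraph false) (gadget_digraph true).
Proof. by exists id; split=> // -[p|[i [j|]]] [q|[i' [j'|]]]. Qed.

(** * Lower bound: no width 2 without the back edges *)

Section LowerBound.
Variable X : abstract_decomposition (gadget_digraph false).
Hypotheses (scdX : SCd_decomposition X) (le3 : forall t : node X, #|Gamma t| <= 3).
Implicit Type t : node X.

(** The triangle is a clique, so some [Gamma t] contains it; the bound 3 forces equality. *)
Lemma triangle_node :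
  exists2 t : node X, Gamma t = triangle & exists p, inl p \in bag_below t.
Proof.
have [||t sub [v]] := @clique_in_Gamma _ X scdX triangle.
- by move=> [p|p] [q|q]; rewrite !mem_triangle.
- by rewrite -card_gt0 card_triangle.
rewrite mem_triangle; case: v => // p _ pt; exists t.
  by apply/esym/eqP; rewrite eqEcard sub card_triangle le3.
by exists p.
Qed.

(** Below a node whose [Gamma] is the triangle, a child containing a vertex of digon [j] is guarded
    inside the triangle. An unguarded [inl q] with [q != Some j] would be pulled below the child by
    the directed triangle digon, exit, [inl q]. *)
Lemma digon_node : exists (j : bool) (t : node X),
  [/\ bag_below t = digon j & forall p, p != Some j -> inl p \in in_guard t].
Proof.
have [t Gt [p pt]] := triangle_node.
(* Choose the gadget whose digon receives edges from [inl p]. *)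
have [j pj] : exists j, p != Some j by case: p {pt} => [[]|]; [exists false|exists true..].
have nG (v : gadget_digraph false) : v \notin triangle -> v \notin in_guard t.
  by rewrite -Gt; apply: contra; apply: (subsetP (in_guard_sub t)).
have ajt : inr (j, Some true) \in bag_below t.
  apply: (proj1 (below_triangle scdX pt (w := inr (j, None)) _ _ _ _ _));
  by rewrite ?nG ?mem_triangle //= eqxx.
have [|s ts ajs] := ex_child ajt; first by rewrite Gt mem_triangle.
have scs := child_strong_component scdX ts.
have gs : in_guard s \subset triangle by rewrite -Gt child_guard_sub.
have nGs (v : gadget_digraph false) : v \notin triangle -> v \notin in_guard s.
  by apply: contra; apply: (subsetP gs).
have nK v : v \in bag_below s -> v \notin triangle.
  by move=> /(below_child scdX ts); rewrite Gt.
exists j, s; split=> [|q qj].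
  apply/eqP; rewrite eqEsubset; apply/andP; split.
    (* Without back edges, only the digon itself and the triangle send edges to the digon, and the
       triangle is excluded from [bag_below s]. *)
    apply: (strong_component_sub scs _ ajs); last by rewrite mem_digon.
    move=> x y /nK; rewrite mem_triangle !mem_digon.
    by case: x y => [p1|[i1 [k1|]]] [p2|[i2 [k2|]]] //= _ /andP[/eqP->].
  apply/subsetP => _ /imsetP[[] _ -> //].
  by apply: (below_adjacent scdX ajs); rewrite /= ?eqxx ?nGs ?mem_triangle.
apply: contraT => qs.
suff /nK : inl q \in bag_below s by rewrite mem_triangle.
apply: (proj2 (below_triangle scdX ajs (v := inr (j, None)) _ _ _ _ qs));
by rewrite ?nGs ?mem_triangle //= eqxx.
Qed.

(** One digon vertex [c] and the two guards fill [Gamma t], so the other digon vertex lies below a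
    child [s]. Each of these three vertices must then guard [s], leaving no room for its bag. *)
Lemma no_width2_decomposition : False.
Proof.
have [j [t [Ct gt]]] := digon_node.
have /set0Pn[c ct] := bag_neq0 scdX t.
have := subsetP (bag_sub_below t) _ ct; rewrite Ct => /imsetP[k _ ck].
pose W : {set gadget_digraph false} :=
  c |: [set inl p | p in [set p : option bool | p != Some j]].
have leW : 3 <= #|W|.
  rewrite cardsU1 ck card_imset; last by move=> p q [].
  have -> : [set p | p != Some j] = [set~ Some j] by apply/setP => p; rewrite !inE.
  rewrite cardsC1 card_option card_bool.
  by case: imsetP => // -[].
have GW : Gamma t = W.
  apply/esym/eqP; rewrite eqEcard (leq_trans (le3 t) leW) andbT.
  apply/subsetP => v; rewrite in_setU1 => /predU1P[->|/imsetP[p]].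
    by rewrite inE ct.
  by rewrite inE => pj ->; apply/(subsetP (in_guard_sub t))/gt.
have nkt : inr (j, Some (~~ k)) \in bag_below t by rewrite Ct mem_digon.
have xW : inr (j, None) \notin W.
  by rewrite in_setU1 ck; apply/norP; split; [apply/eqP | apply/imsetP => -[]].
have nkW : inr (j, Some (~~ k)) \notin W.
  rewrite in_setU1 ck; apply/norP; split; last by apply/imsetP => -[].
  by apply/eqP => -[]; case: (k).
have [|s ts nks] := ex_child nkt; first by rewrite GW.
have gs : in_guard s \subset W by rewrite -GW child_guard_sub.
have nC v : v \in bag_below s -> v \notin W.
  by move=> /(below_child scdX ts); rewrite GW.
have xs : inr (j, None) \notin in_guard s.
  by apply: contra xW; apply: (subsetP gs).
(* Three guards and a nonempty bag would make [Gamma s] have at least four vertices. *)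
suff sub : W \subset in_guard s.
  have := leq_trans (card_in_guard scdX s) (leq_trans (le3 s) leW).
  by rewrite ltnNge => /negP; apply; exact: subset_leq_card.
apply/subsetP => v vW; apply: contraT => vs.
suff /nC : v \in bag_below s by rewrite vW.
have nkns := bag_below_notin scdX nks.
(* An unguarded [c] would be joined to the remaining digon vertex by the digon, and an unguarded
   triangle vertex by a directed triangle through the exit, which is not in [W] and hence not in the
   guard. *)
move: vW; rewrite in_setU1 => /predU1P[vc|/imsetP[p]].
  by apply: (below_adjacent scdX nks) => //; rewrite vc ck /= eqxx /=; case: (k).
rewrite inE => pj vp.
apply: (proj2 (below_triangle scdX nks (v := inr (j, None)) _ _ _ xs vs));
by rewrite //= ?eqxx // vp.
Qed.

End LowerBound.

(** * Upper bound: a decomposition of width at most 2 with the back edges *)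

Section UpperBound.

(** Below the root [None], each gadget [i] has a two-node path: [Some (i, false)] for its exit, then
    [Some (i, true)] for its digon. *)
Definition gadget_node : finType := option (bool * bool).

Definition gadget_arc : rel gadget_node := fun s t =>
  if t is Some (i, b) then s == (if b then Some (i, false) else None) else false.

Definition gadget_bag (t : gadget_node) : {set gadget_digraph true} :=
  match t with
  | None => triangle
  | Some (i, false) => [set inr (i, None)]
  | Some (i, true) => digon i
  end.

Definition gadget_guard (s t : gadget_node) : {set gadget_digraph true} :=
  match t with
  | None => set0
  | Some (i, false) => triangle :\ inl (Some i)
  | Some (i, true) => [set inr (i, None)]
  end.

Lemma mem_gadget_guard s i b v : (v \in gadget_guard s (Some (i, b))) =
  match v with
  | inl p => ~~ b && (p != Some i)
  | inr (i', k) => [&& b, i' == i & k == None]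
  end.
Proof.
case: b; rewrite !inE ?mem_triangle.
  by case: i v => [] [p|[[|] [j|]]].
by case: v => [p|[i' k]]; rewrite ?andbT ?andbF.
Qed.

Lemma gadget_tree : rooted_directed_tree gadget_arc None.
Proof.
have arc1 i : gadget_arc None (Some (i, false)) by [].
split=> //.
  case=> [[i b]|] // _.
  by exists (if b then Some (i, false) else None); split=> [|s /eqP->]; rewrite /= ?eqxx.
case=> [[i [|]]|]; last exact: connect0.
- by apply: connect_trans (connect1 (arc1 i)) _; apply: connect1; rewrite /= eqxx.
- exact: connect1.
Qed.

(** Naming the unique node whose bag holds [v] reduces covering, disjointness and injectivity of the
    bags to equalities of nodes. *)
Lemma mem_gadget_bag v t : (v \in gadget_bag t) =
  (t == match v with
        | inl _ => None
        | inr (i, None) => Some (i, false)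
        | inr (i, Some _) => Some (i, true)
        end).
Proof.
case: t => [[i [|]]|] /=; rewrite ?mem_digon ?mem_triangle ?inE.
- by case: i v => [] [p|[[|] [j|]]].
- by case: i v => [] [p|[[|] [j|]]].
- by case: v => [p|[i [j|]]].
Qed.

Lemma gadget_bag_cover : \bigcup_t gadget_bag t = [set: gadget_digraph true].
Proof.
apply/setP => v; rewrite inE; apply/bigcupP.
by eexists; rewrite // mem_gadget_bag; apply/eqP.
Qed.

Definition gadget_decomposition : abstract_decomposition (gadget_digraph true) :=
  AbstractDecomposition gadget_guard gadget_tree gadget_bag_cover.

Lemma connect_gadget i b t : connect gadget_arc (Some (i, b)) t =
  if t is Some (i', b') then (i' == i) && (b ==> b') else false.
Proof.
apply/idP/idP => [/connectP[p]|]; last first.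
  case: t => [[i' b']|] // /andP[/eqP-> bb'].
  have [<-|neq] := eqVneq b b'; first exact: connect0.
  by apply: connect1; case: b b' bb' neq => [] [] //= _ _; rewrite eqxx.
elim/last_ind: p t => [|p z IHp] t /=; first by move=> _ ->; rewrite eqxx implybb.
rewrite rcons_path last_rcons => /andP[/IHp/(_ erefl) + +] ->.
by case: (last _ p) z => [[i1 b1]|] [[i2 []]|] //= /andP[/eqP-> _] /eqP[->]; rewrite eqxx implybT.
Qed.

Lemma mem_gadget_below i b v :
  (v \in @bag_below _ gadget_decomposition (Some (i, b))) =
  (if v is inr (i', k) then (i' == i) && (b ==> (k != None)) else false).
Proof.
apply/bigcupP/idP => [[t]|].
  rewrite connect_gadget /= mem_gadget_bag => + /eqP tE.
  by rewrite {}tE; case: v => [p|[i' [j|]]].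
move=> vP; eexists; last by rewrite /= mem_gadget_bag.
by rewrite connect_gadget; case: v vP => [p|[i' [j|]]].
Qed.

(** An upper bound for the incident guards, which suffices for both condition (3) and the width. *)
Definition gadget_boundary (t : gadget_node) : {set gadget_digraph true} :=
  match t with
  | None => triangle
  | Some (i, false) => inr (i, None) |: (triangle :\ inl (Some i))
  | Some (i, true) => [set inr (i, None)]
  end.

Lemma gadget_incident_guards t :
  @incident_guards _ gadget_decomposition t \subset gadget_boundary t.
Proof.
rewrite /incident_guards subUset; apply/andP; split; apply/bigcupsP => s /=.
  by case: t => [[i [|]]|] //= _; rewrite subsetUr.
case: s => [[i' [|]]|] //= /eqP->; first by rewrite subsetUl.
exact: subsetDl.
Qed.

Lemma gadget_SCd_decomposition : SCd_decomposition gadget_decomposition.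
Proof.
split.
- have inj : injective gadget_bag.
    move=> s t /setP st.
    pose v : gadget_vertex := match s with
      | None => inl None
      | Some (i, false) => inr (i, None)
      | Some (i, true) => inr (i, Some true)
      end.
    have := st v; rewrite !mem_gadget_bag.
    by rewrite {}/v; case: s {st} => [[i [|]]|]; rewrite eqxx => /esym/eqP->.
  split=> //; apply/and3P; split.
  + by rewrite /cover big_imset /= ?gadget_bag_cover // => s t _ _; apply: inj.
  + apply/trivIsetP => _ _ /imsetP[s _ ->] /imsetP[t _ ->] neq.
    apply/pred0P => v /=; rewrite !mem_gadget_bag.
    by apply/negP => /andP[/eqP sE /eqP tE]; rewrite sE tE eqxx in neq.
  + apply/imsetP => -[t _ /setP t0].
    have := t0 (match t with
      | None => inl None
      | Some (i, false) => inr (i, None)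
      | Some (i, true) => inr (i, Some true)
      end).
    by rewrite inE mem_gadget_bag; case: t {t0} => [[i [|]]|]; rewrite eqxx.
- move=> s [[i b]|] // _.
  apply: (@strong_componentI (gadget_digraph true) _ _ (inr (i, Some true))).
  + by rewrite mem_gadget_below eqxx implybT.
  + move=> v; rewrite mem_gadget_below mem_gadget_guard.
    by case: v => [p|[i' [k|]]] // /andP[/eqP->]; case: b => //=; rewrite eqxx.
  + move=> v w; rewrite !mem_gadget_below.
    case: v w => [p|[i1 k1]] [q|[i2 k2]] //= /andP[/eqP-> _] /andP[/eqP-> _].
    by case: k1 k2 => [[|]|] [[|]|]; rewrite ?eqxx.
  (* With the exit deleted, no edge leaves the digon. With the two triangle vertices other than
     [inl (Some i)] deleted, no edge enters the gadget. *)
  + case: b; [right | left] => v w; rewrite !mem_gadget_below !mem_gadget_guard.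
      by case: i v w => [] [[[]|]|[[] [[]|]]] [[[]|]|[[] [[]|]]].
    by case: i v w => [] [[[]|]|[[] [[]|]]] [[[]|]|[[] [[]|]]].
- move=> t; apply/eqP; rewrite -subset0; apply/subsetP => v.
  rewrite in_setI in_set0 => /andP[/bigcupP[[[i b]|] // /eqP tE vb]].
  move/(subsetP (gadget_incident_guards t)); move: vb; rewrite mem_gadget_below {}tE.
  case: b; rewrite /= ?inE mem_triangle.
    by case: i v => [] [p|[[] [j|]]].
  by case: v => [p|[i' k]].
Qed.

Lemma width_gadget_decomposition : width gadget_decomposition <= 2.
Proof.
apply/leq_width => t.
apply: leq_trans (subset_leq_card (setUS _ (gadget_incident_guards t))) _.
(* The three cases are a digon with its exit, an exit with two triangle vertices, and the
   triangle. *)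
case: t => [[i [|]]|] /=.
- rewrite setUC cardsU1 card_imset; last by move=> j j' [].
  by rewrite card_bool; case: (_ \notin _).
- rewrite setUA setUid cardsU1 cardsDS ?sub1set ?mem_triangle //.
  by rewrite card_triangle cards1; case: (_ \notin _).
- by rewrite setUid card_triangle.
Qed.

End UpperBound.

Theorem theorem4p13 :
  exists D D' : digraph,
    butterfly_minor D' D /\
    exists k k' : nat,
      [/\ SCd_tree_width D k, SCd_tree_width D' k' & k < k'].
Proof.
exists (gadget_digraph true), (gadget_digraph false); split.
  (* Deleting the back edges already gives the minor; no contraction takes place. *)
  exists (gadget_digraph false); split; first exact: subgadget.
  exact: Butterfly_refl.
have [k kP] := @SCd_tree_width_exists (gadget_digraph true) (inl None).
have [k' k'P] := @SCd_tree_width_exists (gadget_digraph false) (inl None).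
exists k, k'; split=> //.
have lek : k <= 2.
  by apply: leq_trans width_gadget_decomposition; apply: kP.2 gadget_SCd_decomposition.
apply: leq_ltn_trans lek _; rewrite ltnNge; apply/negP.
case: k'P => -[X [scdX <-]] _ /leq_width; exact: no_width2_decomposition scdX.
Qed.
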